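(* Let $d\ge2$, $a>0$, $\varepsilon\in(0,1)$, and let $\mathbf X$ be the directed once-reinforced random walk dORRW($a$) on $\mathbb Z^d$ started at the origin, with law $\vec{\mathbb P}^{(a)}$. Fix a sequence $u:\mathbb N\to(0,\infty)$ such that $u_N=o(N^{1/d})$. Let $$\mathcal A_N:=\left\{\mathrm{Ball}(0,(1-\varepsilon)u_N)\subset\vec{\mathfrak G}_{\tau_N}\subset\mathrm{Ball}(0,(1+\varepsilon)u_N)\right\},$$ where the inclusions are inclusions of (oriented) graphs, and define $$\mathcal A:=\bigcup_{m>0}\bigcap_{n>m}\mathcal A_n,\qquad \mathcal B:=\left\{\lim_{N\to\infty}N^{-1/2}\sum_{v\in\partial\mathfrak R_{\tau_N}}\left(\mathbf 1_{\{(v,v-e_1)\notin\vec{\mathfrak C}_{\tau_N}\}}-\mathbf 1_{\{(v,v+e_1)\notin\vec{\mathfrak C}_{\tau_N}\}}\right)=0\right\}.$$ Then $\vec{\mathbb P}^{(a)}(\mathcal A\cap\mathcal B)=0$.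
   Context: $\mathbb Z^d$ is viewed as an oriented graph with an oriented edge $(x,y)$ for each ordered pair of nearest neighbours. dORRW($a$): the right-continuous nearest-neighbour continuous-time process with $X_0=0$ which, when at $i$ at time $t$, jumps to a neighbour $j$ at rate $a$ if the oriented edge $(i,j)$ has not been traversed (from $i$ to $j$) by time $t$, and at rate $1$ otherwise. $(\tau_n)$ are its successive jump times ($\tau_0=0$). $\mathfrak R_t$ is the set of vertices visited by time $t$, $\vec{\mathfrak C}_t$ is the set of oriented edges traversed by time $t$, and $\vec{\mathfrak G}_t=(\mathfrak R_t,\vec{\mathfrak C}_t)$. $\mathrm{Ball}(0,r)$ denotes the oriented subgraph of $\mathbb Z^d$ induced on the set of lattice points of Euclidean norm at most $r$. $e_1=(1,0,\dots,0)$. $\partial\mathfrak R_{\tau_N}$ is the boundary of the range, i.e. the set of vertices of $\mathfrak R_{\tau_N}$ having at least one outgoing oriented edge not in $\vec{\mathfrak C}_{\tau_N}$. *)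

(* Defs.v *)
From HB Require Import structures.
From mathcomp Require Import all_boot all_order all_algebra.
From mathcomp Require Import all_classical all_reals all_analysis.

Set Implicit Arguments.
Unset Strict Implicit.
Unset Printing Implicit Defensive.

Import Order.TTheory GRing.Theory Num.Theory.
Import numFieldNormedType.Exports.

Local Open Scope classical_set_scope.
Local Open Scope ring_scope.

Section Lattice.
Variable d : nat.

Definition unit_step (s : 'I_d * bool) : 'rV[int]_d :=
  (-1) ^+ s.2 *: delta_mx 0 s.1.

Definition neighbour (x y : 'rV[int]_d) : Prop :=
  exists s : 'I_d * bool, y = x + unit_step s.

Definition e1 : 'rV[int]_d := \row_(j < d) (nat_of_ord j == 0%N)%:R.

Record digraph := Digraph {
  vertices : set 'rV[int]_d;
  arcs : set ('rV[int]_d * 'rV[int]_d) }.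

Definition subgraph (G H : digraph) : Prop :=
  vertices G `<=` vertices H /\ arcs G `<=` arcs H.

Definition induced (V : set 'rV[int]_d) : digraph :=
  Digraph V [set e | [/\ V e.1, V e.2 & neighbour e.1 e.2]].

Definition euclid_norm (R : realType) (x : 'rV[int]_d) : R :=
  Num.sqrt (\sum_(j < d) (x 0 j)%:~R ^+ 2).

Definition Ball0 (R : realType) (r : R) : digraph :=
  induced [set x | euclid_norm R x <= r].

End Lattice.

Section Process.
Variables (R : realType) (d : nat) (T : Type).
(* Only the values [X t] with [0 <= t] are meaningful. *)
Variable X : R -> T -> 'rV[int]_d.

(* [tau n w = +oo] when the path [w] has fewer than [n] jumps. *)
Fixpoint tau (n : nat) (w : T) : \bar R :=
  if n is m.+1 then
    ereal_inf [set t%:E | t in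
      [set t : R | (tau m w < t%:E)%E /\ X t w <> X (fine (tau m w)) w]]
  else 0%E.

(* The position after the [n]-th jump, meaningful if [tau n w] is finite. *)
Definition Xtau (n : nat) (w : T) : 'rV[int]_d := X (fine (tau n w)) w.

Definition range_at (t : \bar R) (w : T) : set 'rV[int]_d :=
  [set x | exists s : R, [/\ 0 <= s, (s%:E <= t)%E & X s w = x]].

Definition crossed_at (t : \bar R) (w : T) :
    set ('rV[int]_d * 'rV[int]_d) :=
  [set e | exists n, [/\ (tau n.+1 w < +oo)%E, (tau n.+1 w <= t)%E &
                         e = (Xtau n w, Xtau n.+1 w)]].

Definition graph_at (t : \bar R) (w : T) : digraph d :=
  Digraph (range_at t w) (crossed_at t w).

Definition boundary_at (t : \bar R) (w : T) : set 'rV[int]_d :=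
  [set v | range_at t w v /\
           exists y, neighbour v y /\ ~ crossed_at t w (v, y)].

Definition jump_rate (a : R) (t : \bar R) (w : T) (i j : 'rV[int]_d) : R :=
  if (i, j) \in crossed_at t w then 1 else a.

Definition history (n : nat) : set (set T) :=
  <<s [set E | exists k, (k <= n)%N /\
         ((exists x, E = [set w | Xtau k w = x]) \/
          (exists t : R, E = [set w | (tau k w <= t%:E)%E]))] >>.

End Process.

(* The rates are constant between two jumps, so jumping from [i] to each
   neighbour [j] at rate [r j] means: given the history up to the [n]-th jump,
   the next holding time is exponential of parameter [\sum_j r j] and,
   independently, the next position is [j] with probability proportional to
   [r j].  This is expressed on each history event [H] on which the current
   position and rates are fixed.  These probabilities sum to 1 over the
   neighbours, so that almost surely every [tau n] is finite and every jump is
   to a nearest neighbour. *)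
Record is_dORRW (R : realType) (d : nat) (a : R) (disp : measure_display)
    (T : measurableType disp) (P : probability T R)
    (X : R -> T -> 'rV[int]_d) : Prop := IsDORRW {
  dORRW_measurable : forall (t : R) (x : 'rV[int]_d), 0 <= t ->
    measurable [set w | X t w = x];
  dORRW_right_continuous : forall (w : T) (t : R), 0 <= t ->
    \forall s \near t^'+, X s w = X t w;
  dORRW_start : forall w : T, X 0 w = 0;
  dORRW_jump : forall (n : nat) (H : set T) (i : 'rV[int]_d)
      (r : 'I_d * bool -> R),
    history X n H ->
    (forall w, H w ->
       [/\ (tau X n w < +oo)%E, Xtau X n w = i &
           forall e, jump_rate X a (tau X n w) w i (i + unit_step e) = r e]) ->
    forall (e : 'I_d * bool) (s : R), 0 <= s ->
    P (H `&` [set w | [/\ (tau X n w + s%:E < tau X n.+1 w)%E,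
                          (tau X n.+1 w < +oo)%E &
                          Xtau X n.+1 w = i + unit_step e]]) =
    (P H * (expR (- (\sum_e' r e') * s) * (r e / \sum_e' r e'))%:E)%E }.

Section Events.
Variables (R : realType) (d : nat) (T : Type) (X : R -> T -> 'rV[int]_d).

Definition event_A_at (eps : R) (u : nat -> R) (N : nat) : set T :=
  [set w | subgraph (Ball0 d ((1 - eps) * u N)) (graph_at X (tau X N w) w) /\
           subgraph (graph_at X (tau X N w) w) (Ball0 d ((1 + eps) * u N))].

Definition event_A (eps : R) (u : nat -> R) : set T :=
  \bigcup_(m in [set m | (0 < m)%N])
    \bigcap_(n in [set n | (m < n)%N]) event_A_at eps u n.

Definition boundary_imbalance (N : nat) (w : T) : R :=
  let C := crossed_at X (tau X N w) w in
  \sum_(v \in boundary_at X (tau X N w) w)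
    (((v, v - e1 d) \notin C)%:R - ((v, v + e1 d) \notin C)%:R : R).

Definition event_B : set T :=
  [set w | (N%:R `^ (- 2^-1) * boundary_imbalance N w : R) @[N --> \oo]
           --> (0 : R)].

End Events.

(* Main.v *)
Require Import Defs.
From HB Require Import structures.
From mathcomp Require Import all_boot all_order all_algebra.
From mathcomp Require Import all_classical all_reals all_analysis.
From mathcomp Require Import ring lra.

(* Let D_N be the boundary imbalance at time tau_N.  The sites of the range off
   the boundary contribute 0, so D_N is the number of arcs crossed so far in the
   direction e_1 minus the number of those crossed in the direction - e_1.  A
   step along the axis e_1 discovers a new arc at rate a and reuses an old one
   at rate 1, so the drift of D_N is - a times the drift of the signed number of
   repeated crossings, and
     M_N = (1 - a) D_N + a (first coordinate of X_{tau_N})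
   is a martingale with bounded increments and conditional variances bounded
   below.  On A the walk stays within 2 u_N = o(sqrt N), as d >= 2, and on B
   also D_N = o(sqrt N), so M_N = o(sqrt N) on both.  Optional stopping for
   M_N^2 shows that, for every D > 0, the event |M_N| <= D sqrt N for all
   N >= m has probability O(D^2), uniformly in m. *)

Set Implicit Arguments.
Unset Strict Implicit.
Unset Printing Implicit Defensive.

Import Order.TTheory GRing.Theory Num.Theory.
Import numFieldNormedType.Exports.

Local Open Scope classical_set_scope.
Local Open Scope ring_scope.

(** * Pathwise description of the explored graph *)

Section PathwiseJumps.
Variables (R : realType) (d : nat) (T : Type) (X : R -> T -> 'rV[int]_d).
Hypothesis Xrc : forall (w : T) (t : R), 0 <= t ->
  \forall s \near t^'+, X s w = X t w.

Lemma tau_leS n w : (tau X n w <= tau X n.+1 w)%E.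
Proof. by apply: le_ereal_inf_tmp => _ [t [/ltW ? _] <-]. Qed.

Lemma tau_le n m w : (n <= m)%N -> (tau X n w <= tau X m w)%E.
Proof.
move=> /subnK <-; elim: (m - n)%N => [|k IH]; first exact: le_refl.
exact: le_trans IH (tau_leS _ _).
Qed.

Lemma tau_ge0 n w : (0 <= tau X n w)%E.
Proof. exact: (@tau_le 0 n). Qed.

Lemma tau_fineK n w : (tau X n w < +oo)%E -> (fine (tau X n w))%:E = tau X n w.
Proof. by move=> h; rewrite fineK// ge0_fin_numE// tau_ge0. Qed.

Lemma fine_tau_ge0 n w : 0 <= fine (tau X n w).
Proof. by rewrite fine_ge0// tau_ge0. Qed.

(** Right continuity keeps the path constant on some [[t, t + e)] with [t] the [n]-th jump time, so
    the infimum defining the next jump time is at least [t + e]. *)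
Lemma tau_ltS n w : (tau X n w < +oo)%E -> (tau X n w < tau X n.+1 w)%E.
Proof.
move=> h; set t := fine (tau X n w).
have tE : t%:E = tau X n w by exact: tau_fineK.
have [e /= e0 He] := Xrc w (fine_tau_ge0 n w).
apply: (@lt_le_trans _ _ (t + e)%:E); first by rewrite -tE lte_fin ltrDl.
apply: le_ereal_inf_tmp => _ [s [ts Xs] <-].
rewrite lee_fin leNgt; apply/negP => se; apply: Xs; apply: He => //=.
  rewrite -tE lte_fin in ts.
  by rewrite /ball/= distrC ger0_norm ?subr_ge0 ?ltW// ltrBlDl.
by rewrite -lte_fin tE.
Qed.

Lemma X_before_next n w (s : R) : (tau X n w <= s%:E)%E ->
  (s%:E < tau X n.+1 w)%E -> X s w = Xtau X n w.
Proof.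
move=> ns sn; have h : (tau X n w < +oo)%E by exact: le_lt_trans ns (ltry _).
move: ns; rewrite le_eqVlt => /orP[/eqP ns|ns].
  by rewrite /Xtau ns.
apply: contrapT => Xs; move: sn; rewrite ltNge => /negP; apply.
by apply: ereal_inf_lbound; exists s.
Qed.

(** The path is constant between jumps, so the real times in [range_at] reduce to the finite jump
    times. *)
Lemma range_at_tau N w : range_at X (tau X N w) w =
  [set x | exists k, [/\ (k <= N)%N, (tau X k w < +oo)%E & Xtau X k w = x]].
Proof.
apply/seteqP; split => x /=; last first.
  move=> [k [kN h <-]]; exists (fine (tau X k w)); split => //.
    exact: fine_tau_ge0.
  by rewrite tau_fineK// tau_le.
move=> [s [s0 sN <-]]; elim: N sN => [|N IH] sN.
  exists 0%N; rewrite /= ltry; split => //.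
  by rewrite /Xtau/=; congr X; apply/eqP; rewrite eq_le s0 -lee_fin sN.
have [sN'|Ns] := leP s%:E (tau X N w).
  by have [k [kN h Xk]] := IH sN'; exists k; split => //; exact: leqW.
move: sN; rewrite le_eqVlt => /orP[/eqP sN|sN].
  by exists N.+1; rewrite /Xtau -sN ltry.
exists N; rewrite (X_before_next (ltW Ns) sN); split => //.
exact: lt_trans Ns (ltry _).
Qed.

(** Finite jump times increase strictly, so a crossing completed by time [tau N] has index below
    [N]. *)
Lemma crossed_at_tau N w : crossed_at X (tau X N w) w =
  [set e | exists k, [/\ (k < N)%N, (tau X k.+1 w < +oo)%E &
                         e = (Xtau X k w, Xtau X k.+1 w)]].
Proof.
apply/seteqP; split => e /= [k [h1 h2 ->]]; exists k; split => //.
  rewrite ltnNge; apply/negP => Nk; move: h2; rewrite leNgt => /negP; apply.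
  have hk : (tau X k w < +oo)%E by exact: le_lt_trans (tau_leS _ _) h1.
  exact: le_lt_trans (tau_le _ Nk) (tau_ltS hk).
exact: tau_le.
Qed.

(** [None] records that jump [n] never happens, in which case [Xtau] carries no information. *)
Definition position n w : option 'rV[int]_d :=
  if (tau X n w < +oo)%E then Some (Xtau X n w) else None.

Lemma position_Some n w x : position n w = Some x <->
  (tau X n w < +oo)%E /\ Xtau X n w = x.
Proof.
rewrite /position; case: ifP => h; split.
- by case=> <-.
- by case=> _ ->.
- by [].
- by case.
Qed.

(** [F] depends only on the discrete skeleton up to jump [n], which has countably many values; this
    is the route to measurability. *)
Definition determined_upto U (F : T -> U) n :=
  forall w w', (forall k, (k <= n)%N -> position k w = position k w') ->
  F w = F w'.

Lemma determined_range N :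
  determined_upto (fun w => range_at X (tau X N w) w) N.
Proof.
suff H w w' : (forall k, (k <= N)%N -> position k w = position k w') ->
  range_at X (tau X N w) w `<=` range_at X (tau X N w') w'.
  by move=> w w' h; apply/seteqP; split; apply: H => // k /h.
move=> h; rewrite !range_at_tau => x [k [kN kf kx]]; exists k.
have : position k w = Some x by apply/position_Some.
by rewrite h// => /position_Some[].
Qed.

Lemma determined_crossed N :
  determined_upto (fun w => crossed_at X (tau X N w) w) N.
Proof.
suff H w w' : (forall k, (k <= N)%N -> position k w = position k w') ->
  crossed_at X (tau X N w) w `<=` crossed_at X (tau X N w') w'.
  by move=> w w' h; apply/seteqP; split; apply: H => // k /h.
move=> h; rewrite !crossed_at_tau => x [k [kN kf ->]]; exists k.
have kf' : (tau X k w < +oo)%E by exact: le_lt_trans (tau_leS _ _) kf.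
have : position k.+1 w = Some (Xtau X k.+1 w) by apply/position_Some.
rewrite h// => /position_Some[hf ->].
have : position k w = Some (Xtau X k w) by apply/position_Some.
by rewrite h// ?(ltnW kN)// => /position_Some[hf' ->].
Qed.

Lemma determined_imbalance N : determined_upto (boundary_imbalance X N) N.
Proof.
move=> w w' h; rewrite /boundary_imbalance /boundary_at.
by rewrite (determined_range h) (determined_crossed h).
Qed.

Lemma determined_event_A eps u N : determined_upto (event_A_at X eps u N) N.
Proof.
move=> w w' h; rewrite /event_A_at /graph_at /=.
by rewrite (determined_range h) (determined_crossed h).
Qed.

Lemma determined_Xtau N : (forall w, X 0 w = 0) -> determined_upto (Xtau X N) N.
Proof.
move=> X0.
have H w : Xtau X N w = odflt 0 (position N w).
  rewrite /position; case: ifP => //= /negbT; rewrite -leNgt leye_eq => /eqP h.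
  (* At an infinite jump time [fine] returns 0, so the default position is the origin. *)
  by rewrite /Xtau h /= X0.
by move=> w w' h; rewrite !H h.
Qed.

End PathwiseJumps.

(** * Measurability of the events *)

Section CountableQuantifiers.
Variables (disp : measure_display) (T : measurableType disp) (U : countType).

Lemma measurable_ex (F : U -> set T) :
  (forall i, measurable (F i)) -> measurable [set w | exists i, F i w].
Proof.
move=> mF; rewrite (_ : [set w | _] = \bigcup_i F i).
  exact: countable_bigcupT_measurable (countableP _) mF.
by apply/seteqP; split => w /= [i]; [exists i|exists i].
Qed.

Lemma measurable_all (F : U -> set T) :
  (forall i, measurable (F i)) -> measurable [set w | forall i, F i w].
Proof.
move=> mF; rewrite (_ : [set w | _] = ~` [set w | exists i, (~` F i) w]).
  by apply/measurableC/measurable_ex => i; exact: measurableC.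
apply/seteqP; split => w /= h; first by case=> i /(_ (h i)).
by move=> i; apply: contrapT => n; apply: h; exists i.
Qed.

End CountableQuantifiers.

Lemma measurable_imply (disp : measure_display) (T : measurableType disp)
    (A B : set T) :
  measurable A -> measurable B -> measurable [set w | A w -> B w].
Proof.
move=> mA mB; rewrite (_ : [set w | _] = ~` A `|` B).
  by apply: measurableU => //; exact: measurableC.
apply/seteqP; split => w /=.
  by move=> h; have [/h|] := pselect (A w); [right|left].
by case.
Qed.

(** * Measurability of jump times, positions and events of the skeleton *)

Section MeasurableJumps.
Variables (R : realType) (d : nat) (disp : measure_display).
Variables (T : measurableType disp) (X : R -> T -> 'rV[int]_d).
Hypothesis Xmeas : forall (t : R) (x : 'rV[int]_d), 0 <= t ->
  measurable [set w | X t w = x].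
Hypothesis Xrc : forall (w : T) (t : R), 0 <= t ->
  \forall s \near t^'+, X s w = X t w.

Lemma rat_right (t e : R) : 0 < e -> exists q : rat, t < ratr q < t + e.
Proof.
move=> e0; have [|q] := @rat_in_itvoo _ t (t + e); first by rewrite ltrDl.
by rewrite in_itv/= => h; exists q.
Qed.

(* By right continuity, the position at a random time is the common value of
   the path at all rational times slightly after it. *)
Lemma measurable_Xtau_fin n x :
  (forall t : R, measurable [set w | (tau X n w < t%:E)%E]) ->
  measurable [set w | (tau X n w < +oo)%E /\ Xtau X n w = x].
Proof.
move=> mtau.
rewrite (_ : [set w | _] = [set w | exists k : nat, (tau X n w < k%:R%:E)%E] `&`
  [set w | exists k : nat, forall q : rat, (tau X n w < (ratr q)%:E)%E ->
     (~ (tau X n w < (ratr q - k.+1%:R^-1)%:E)%E -> X (ratr q) w = x)]).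
  apply: measurableI; apply: measurable_ex => k; first exact: mtau.
  apply: measurable_all => q.
  have [q0|q0] := leP 0 (ratr q : R).
    apply: (@measurable_imply _ _ [set w | (tau X n w < (ratr q)%:E)%E]
      [set w | ~ (tau X n w < _)%E -> X (ratr q) w = x]) => //.
    by apply: (@measurable_imply _ _ (~` [set w | (tau X n w < _)%E])
      [set w | X (ratr q) w = x]); [exact/measurableC/mtau|exact: Xmeas].
  rewrite [X in measurable X](_ : _ = setT); first exact: measurableT.
  apply/seteqP; split => w //= _ h.
  exfalso; move: h; apply/negP; rewrite -leNgt.
  by apply: le_trans (tau_ge0 X n w); rewrite lee_fin ltW.
apply/seteqP; split => w /=.
  move=> [h Xx]; have tE := tau_fineK h; set t := fine (tau X n w) in tE.
  have t0 : 0 <= t by exact: fine_tau_ge0.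
  split.
    by exists (Num.bound t); rewrite -tE lte_fin; exact: archi_boundP t0.
  have [e /= e0 He] := Xrc w t0.
  exists (Num.bound e^-1) => q; rewrite -tE !lte_fin => tq /negP.
  rewrite -leNgt lerBlDr => qt; rewrite -Xx; apply: He => //=.
  rewrite /ball/= distrC gtr0_norm ?subr_gt0// ltrBlDl.
  apply: le_lt_trans qt _; rewrite ltrD2l invf_plt ?posrE//.
  apply: lt_le_trans (_ : (Num.bound e^-1)%:R <= _); last by rewrite ler_nat.
  by apply: archi_boundP; rewrite invr_ge0 ltW.
move=> [[k hk] [m hm]].
have h : (tau X n w < +oo)%E by exact: lt_trans hk (ltry _).
split => //; have tE := tau_fineK h; set t := fine (tau X n w) in tE.
have t0 : 0 <= t by exact: fine_tau_ge0.
have [e /= e0 He] := Xrc w t0.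
have [|q /andP[tq qt]] := @rat_right t (Num.min e m.+1%:R^-1).
  by rewrite lt_min e0 /= invr_gt0.
rewrite -(hm q).
- rewrite /Xtau -/t; apply/esym; apply: He => //=.
  rewrite /ball/= distrC gtr0_norm ?subr_gt0// ltrBlDl.
  by apply: lt_le_trans qt _; rewrite lerD2l ge_min lexx.
- by rewrite -tE lte_fin.
- rewrite -tE lte_fin; apply/negP; rewrite -leNgt lerBlDr.
  by apply: le_trans (ltW qt) _; rewrite lerD2l ge_min lexx orbT.
Qed.

(** Induction on [n]: the next jump comes before [t] iff at some rational time below [t], after jump
    [n], the path has left [Xtau n]. Right continuity allows the time to be rational. *)
Lemma measurable_tau_lt n (t : R) : measurable [set w | (tau X n w < t%:E)%E].
Proof.
elim: n t => [|n IH] t /=.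
  have [t0|t0] := boolP (0%:E < t%:E)%E.
    by rewrite [X in measurable X](_ : _ = setT)//; apply/seteqP; split => w /=.
  rewrite [X in measurable X](_ : _ = set0)//; apply/seteqP; split => w //=.
rewrite (_ : [set w | _] = [set w | exists q : rat, exists x : 'rV[int]_d,
   ([set w | (tau X n w < (ratr q)%:E)%E /\ ratr q < t] `&`
   ([set w | (tau X n w < +oo)%E /\ Xtau X n w = x] `\`
     [set w | X (ratr q) w = x])) w]).
  apply: measurable_ex => q; apply: measurable_ex => x.
  have [q0|q0] := leP 0 (ratr q : R); last first.
    rewrite [X in measurable X](_ : _ = set0)//.
    apply/seteqP; split => w //= [[+ _] _].
    move/(le_lt_trans (tau_ge0 X n w)); rewrite lte_fin => /lt_trans /(_ q0).
    by rewrite ltxx.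
  apply: measurableI.
    have [qt|qt] := boolP ((ratr q : R) < t).
      rewrite [X in measurable X](_ : _ =
        [set w | (tau X n w < (ratr q)%:E)%E])//.
      by apply/seteqP; split => w //= [].
    rewrite [X in measurable X](_ : _ = set0)//.
    by apply/seteqP; split => w //= [].
  by apply: measurableD; [exact: measurable_Xtau_fin|exact: Xmeas].
apply/seteqP; split => w /=.
  move=> /ereal_inf_lt[_ [s [ns Xs] <-]]; rewrite lte_fin => st.
  have s0 : 0 <= s.
    by rewrite -lee_fin; apply: le_trans (tau_ge0 X n w) (ltW ns).
  have [e /= e0 He] := Xrc w s0.
  have [|q /andP[sq qs]] := @rat_right s (Num.min e (t - s)).
    by rewrite lt_min e0 /= subr_gt0.
  exists q; exists (Xtau X n w); split.
    split; first by rewrite (lt_trans ns)// lte_fin.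
    by apply: lt_le_trans qs _; rewrite -lerBrDl ge_min lexx orbT.
  split; first by split => //; exact: lt_trans ns (ltry _).
  rewrite /= He//= /ball/= distrC gtr0_norm ?subr_gt0// ltrBlDl.
  by apply: lt_le_trans qs _; rewrite lerD2l ge_min lexx.
move=> [q [x [[nq qt] [[_ nx] Xq]]]].
apply: (@le_lt_trans _ _ (ratr q)%:E); last by rewrite lte_fin.
apply: ereal_inf_lbound; exists (ratr q) => //; split => //.
by rewrite -/(Xtau _ _ _) nx.
Qed.

Lemma measurable_position n z : measurable [set w | position X n w = z].
Proof.
have mS x : measurable [set w | position X n w = Some x].
  rewrite [X in measurable X](_ : _ =
      [set w | (tau X n w < +oo)%E /\ Xtau X n w = x]).
    by apply: measurable_Xtau_fin => t; exact: measurable_tau_lt.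
  by apply/seteqP; split => w /= /position_Some.
case: z => [x|]; first exact: mS.
rewrite [X in measurable X](_ : _ =
    ~` [set w | exists x, position X n w = Some x]).
  by apply: measurableC; apply: measurable_ex.
apply/seteqP; split => w /=; first by move=> -> [].
by case: (position X n w) => // x []; exists x.
Qed.

(* The events of the theorem quantify over all real times up to [tau N], and
   [P] has junk values on non-measurable sets; they are measurable because they
   only depend on finitely many variables with countably many values. *)
Lemma measurable_determined n (E : set T) :
  determined_upto X E n -> measurable E.
Proof.
move=> hE.
pose past w := [seq position X k w | k <- iota 0 n.+1].
have mpast l h : measurable [set w | [seq position X k w | k <- l] = h].
  elim: l h => [|k l IH] [|z h].
  - by rewrite [X in measurable X](_ : _ = setT)//; apply/seteqP; split => w /=.
  - by rewrite [X in measurable X](_ : _ = set0)//; apply/seteqP; split => w /=.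
  - by rewrite [X in measurable X](_ : _ = set0)//; apply/seteqP; split => w /=.
  rewrite [X in measurable X](_ : _ = [set w | position X k w = z] `&`
     [set w | [seq position X k w | k <- l] = h]).
    by apply: measurableI; [exact: measurable_position|exact: IH].
  by apply/seteqP; split => w /= [-> ->].
(* [E] is the countable union of the fibres of [past] that it meets. *)
rewrite (_ : E = [set w | exists h : seq (option 'rV[int]_d),
   ([set w | past w = h] `&` [set w | exists w', past w' = h /\ E w']) w]).
  apply: measurable_ex => h; apply: measurableI; first exact: mpast.
  have [hh|hh] := pselect (exists w', past w' = h /\ E w').
    by rewrite [X in measurable X](_ : _ = setT)//; apply/seteqP; split => w /=.
  by rewrite [X in measurable X](_ : _ = set0)//; apply/seteqP; split => w /=.
apply/seteqP; split => w /=.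
  by move=> Ew; exists (past w); split => //; exists w.
move=> [h [wh [w' [w'h Ew']]]]; rewrite (hE w w')// => k kn.
have /eq_in_map : past w = past w' by rewrite wh w'h.
by apply; rewrite mem_iota.
Qed.

End MeasurableJumps.

(** * Confinement of martingales with finitely many steps *)

(** New letters are put in front, so sums over walks split according to the latest step. *)
Fixpoint walks (S : finType) (n : nat) : seq (seq S) :=
  if n is m.+1 then [seq e :: s | s <- walks S m, e <- index_enum S]
  else [:: [::]].

Lemma big_walksS (V : nmodType) (S : finType) (n : nat) (F : seq S -> V) :
  \sum_(s <- walks S n.+1) F s = \sum_(s <- walks S n) \sum_e F (e :: s).
Proof. exact: big_allpairs_dep. Qed.

Lemma size_walks (S : finType) n (s : seq S) : s \in walks S n -> size s = n.
Proof.
elim: n s => [|n IH] s /=; first by rewrite inE => /eqP ->.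
by move=> /allpairsP[[t e] /= [/IH <- _ ->]].
Qed.

(* Confinement of a martingale on the tree of walks: [q s e] is the probability
   of the step [e] after the walk [s] (latest step first), [D s e] the
   increment of the martingale along this step. *)
Section Confinement.
Variables (R : realType) (S : finType) (q D : seq S -> S -> R) (c K : R).
Hypotheses (q_ge0 : forall s e, 0 <= q s e)
  (q_sum : forall s, \sum_e q s e = 1).
Hypotheses (D_mean : forall s, \sum_e q s e * D s e = 0)
  (D_var : forall s, c <= \sum_e q s e * D s e ^+ 2)
  (D_bound : forall s e, `|D s e| <= K) (c_ge0 : 0 <= c) (K_ge0 : 0 <= K).

Fixpoint mass (s : seq S) : R :=
  if s is e :: s' then mass s' * q s' e else 1.

Fixpoint mart (s : seq S) : R := if s is e :: s' then mart s' + D s' e else 0.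

(** The tails of [s] are the earlier states of the walk, so the bound is imposed at every time from
    [m] to the present. *)
Fixpoint confined (m : nat) (b : R) (s : seq S) : bool :=
  ((m <= size s)%N ==> (`|mart s| <= b)) &&
  (if s is _ :: s' then confined m b s' else true).

Lemma confined_tail m b e s : confined m b (e :: s) -> confined m b s.
Proof. by move=> /= /andP[]. Qed.

Lemma confined_bound m b s :
  confined m b s -> (m <= size s)%N -> `|mart s| <= b.
Proof. by case: s => [|e s] /andP[/implyP]. Qed.

Lemma mass_ge0 s : 0 <= mass s.
Proof. by elim: s => //= e s IH; rewrite mulr_ge0. Qed.

Lemma sum_mass n : \sum_(s <- walks S n) mass s = 1.
Proof.
elim: n => [|n IH]; first by rewrite big_seq1.
rewrite big_walksS -[RHS]IH; apply: eq_bigr => s _ /=.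
by rewrite -mulr_sumr q_sum mulr1.
Qed.

(* Optional stopping at the exit time of the interval [-b, b], without naming
   the exit time: [M^2 - (b + K)^2] is nonpositive until one step after the
   exit, and grows by at least [c] on average per step. *)
Lemma sum_confined m n b : (m <= n)%N ->
  c * (n - m)%:R * \sum_(s <- walks S n | confined m b s) mass s
    <= (b + K) ^+ 2.
Proof.
move=> mn.
pose f s := mart s ^+ 2 - (b + K) ^+ 2.
pose F j := \sum_(s <- walks S j | confined m b s) mass s * f s.
pose g j := \sum_(s <- walks S j | confined m b s) mass s.
rewrite -/(g n).
have sqr_le x B : `|x| <= B -> x ^+ 2 <= B ^+ 2 :> R.
  move=> xB; rewrite -real_normK ?num_real// lerXn2r// nnegrE//.
  exact: le_trans xB.
have gS j : g j.+1 <= g j.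
  rewrite /g big_mkcond big_walksS [leRHS]big_mkcond; apply: ler_sum => s _.
  have [cs|cs] := boolP (confined m b s).
    rewrite -[leRHS]mulr1 -(q_sum s) mulr_sumr; apply: ler_sum => e _.
    by case: ifP => // _; rewrite mulr_ge0// mass_ge0.
  rewrite big1// => e _; case: ifP => // /confined_tail.
  by rewrite (negbTE cs).
have g_mono i j : (i <= j)%N -> g j <= g i.
  move=> /subnK <-; elim: (j - i)%N => // k IH.
  exact: le_trans (gS _) IH.
have g_ge0 j : 0 <= g j by apply: sumr_ge0 => s _; exact: mass_ge0.
have g_le1 j : g j <= 1.
  rewrite -(sum_mass j) /g big_mkcond; apply: ler_sum => s _.
  by case: ifP => // _; exact: mass_ge0.
have f_next s e : confined m b s -> (m <= size s)%N -> f (e :: s) <= 0.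
  move=> cs ms; rewrite /f subr_le0; apply: sqr_le.
  apply: le_trans (ler_normD _ _) _.
  by apply: lerD => //; exact: confined_bound ms.
have FS j : (m <= j)%N -> F j + c * g j <= F j.+1.
  move=> mj; rewrite /F /g mulr_sumr -big_split [leLHS]big_mkcond /=.
  rewrite [leRHS]big_mkcond big_walksS big_seq [leRHS]big_seq.
  apply: ler_sum => s /size_walks sj.
  have [cs|cs] := boolP (confined m b s); last first.
    rewrite big1// => e _; case: ifP => // /confined_tail.
    by rewrite (negbTE cs).
  (* Extensions of [s] that leave the interval have [f <= 0], so dropping them can only raise the
     sum. *)
  apply: (@le_trans _ _ (\sum_e mass s * q s e * f (e :: s))); last first.
    apply: ler_sum => e _; case: ifP => // _.
    by rewrite mulr_ge0_le0 ?f_next ?sj// mulr_ge0// mass_ge0.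
  rewrite (_ : \sum_e _ = mass s * (f s + \sum_e q s e * D s e ^+ 2)).
    by rewrite [leRHS]mulrDr lerD2l mulrC ler_wpM2l// mass_ge0.
  under eq_bigr do rewrite -mulrA.
  rewrite -mulr_sumr; congr (_ * _).
  transitivity (\sum_e (q s e * f s + 2 * mart s * (q s e * D s e)
                        + q s e * D s e ^+ 2)).
    by apply: eq_bigr => e _; rewrite /f /=; ring.
  by rewrite !big_split /= -mulr_suml -mulr_sumr D_mean q_sum mul1r mulr0 addr0.
(* As [g] decreases, its last value bounds from below the gain of every earlier step. *)
have FN k : F m + c * k%:R * g (m + k)%N <= F (m + k)%N.
  elim: k => [|k IH]; first by rewrite mulr0 mul0r addr0 addn0.
  rewrite addnS; apply: le_trans (FS (m + k)%N (leq_addr _ _)).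
  apply: le_trans (lerD IH (lexx _)).
  rewrite -addrA lerD2l -natr1 mulrDr mulr1 mulrDl lerD//.
    by rewrite ler_wpM2l// mulr_ge0.
  by rewrite ler_wpM2l.
have {FN} := FN (n - m)%N; rewrite subnKC// => FN.
have F_le0 : F n <= 0.
  rewrite /F big_seq_cond; apply: sumr_le0 => s /andP[/size_walks sn cs].
  rewrite mulr_ge0_le0 ?mass_ge0// /f subr_le0; apply: sqr_le.
  by apply: le_trans (confined_bound cs _) _; rewrite ?sn// lerDl.
(* Here [f] is at least [- (b + K) ^+ 2] and the total mass [g m] is at most 1. *)
have F_ge : - (b + K) ^+ 2 <= F m.
  apply: (@le_trans _ _ (- (b + K) ^+ 2 * g m)).
    by rewrite -[leLHS]mulr1 ler_wnM2l// oppr_le0 sqr_ge0.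
  rewrite mulr_sumr; apply: ler_sum => s _.
  by rewrite mulrC ler_wpM2l ?mass_ge0// /f lerDr sqr_ge0.
by lra.
Qed.

End Confinement.

(** * The martingale of the walk *)

Section Steps.
Variables (d : nat) (i0 : 'I_d).
Hypothesis i00 : i0 = 0%N :> nat.
Local Notation step := ('I_d * bool)%type.
Local Notation site := 'rV[int]_d.

Lemma unit_step_coord (e : step) j :
  unit_step e 0 j = (e.1 == j)%:R * (-1) ^+ e.2.
Proof. by rewrite !mxE eqxx /= eq_sym mulrC. Qed.

Lemma unit_step_inj : injective (@unit_step d).
Proof.
move=> [i b] [j c] /rowP/(_ i); rewrite !unit_step_coord /= eqxx.
have [->|ji] := eqVneq j i; first by rewrite !mul1r => /signr_inj ->.
by rewrite mul1r mul0r => /eqP; rewrite signr_eq0.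
Qed.

Lemma e1_unit_step : e1 d = unit_step (i0, false).
Proof.
by apply/rowP => j; rewrite unit_step_coord mxE mulr1 -i00 eq_sym.
Qed.

Lemma opp_e1_unit_step : - e1 d = unit_step (i0, true).
Proof. by rewrite e1_unit_step /unit_step expr1 expr0 scaleN1r scale1r. Qed.

Variable R : realType.

Definition dir (e : step) : R := (e.1 == i0)%:R * (-1) ^+ e.2.

Lemma dirE e :
  dir e = (unit_step e == e1 d)%:R - (unit_step e == - e1 d)%:R.
Proof.
rewrite opp_e1_unit_step e1_unit_step !(inj_eq unit_step_inj) /dir.
case: e => i b; rewrite !xpair_eqE /=; case: eqP => _ /=.
  by case: b; rewrite ?subr0 ?sub0r mul1r.
by rewrite mul0r subr0.
Qed.

Lemma sum_dir_fun (F : R -> R) : F 0 = 0 ->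
  \sum_(e : step) F (dir e) = F 1 + F (-1).
Proof.
move=> F0; rewrite -(pair_bigA _ (fun i b => F (dir (i, b)))) /= (bigD1 i0)//=.
rewrite [X in _ + X]big1 ?addr0 => [|i /negbTE i_i0].
  by rewrite big_bool /dir/= eqxx !mul1r addrC.
by rewrite big1// => b _; rewrite /dir /= i_i0 mul0r.
Qed.

Fixpoint endpoint (s : seq step) : site :=
  if s is e :: s' then endpoint s' + unit_step e else 0.

Fixpoint visited (s : seq step) : seq site :=
  if s is e :: s' then endpoint s :: visited s' else [:: 0].

Fixpoint trail (s : seq step) : seq (site * site) :=
  if s is e :: s' then (endpoint s', endpoint s) :: trail s' else [::].

Lemma endpoint_visited s : endpoint s \in visited s.
Proof. by case: s => [|e s] /=; rewrite mem_head. Qed.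

Lemma trail_source s x : x \in trail s -> x.1 \in visited s.
Proof.
elim: s => //= e s IH; rewrite !inE => /orP[/eqP ->|/IH ->]; rewrite ?orbT//=.
by rewrite endpoint_visited orbT.
Qed.

(** The tail holds the earlier crossings, so each arc counts at its first crossing only: this is the
    signed number of distinct arcs along the first axis. *)
Fixpoint imbalance (C : seq (site * site)) : R :=
  if C is x :: C' then
    imbalance C' + (x \notin C')%:R *
      ((x.2 - x.1 == e1 d)%:R - (x.2 - x.1 == - e1 d)%:R)
  else 0.

(** Before any crossing the two indicators cancel at every site. The first crossing of an arc in
    direction [e1] removes the negative indicator at its source and adds 1 to the sum; in direction
    [- e1] it subtracts 1; no other summand changes. *)
Lemma sum_imbalance (V : seq site) (C : seq (site * site)) :
  uniq V -> (forall x, x \in C -> x.1 \in V) ->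
  \sum_(v <- V) (((v, v - e1 d) \notin C)%:R - ((v, v + e1 d) \notin C)%:R)
  = imbalance C.
Proof.
move=> uV; elim: C => [|[x y] C IH] CV /=.
  by rewrite big1// => v _; rewrite subrr.
rewrite -IH => [|z zC]; last by rewrite CV// inE zC orbT.
have xV : x \in V by have := CV _ (mem_head _ _).
have [xyC|xyC] := boolP ((x, y) \in C).
  rewrite mul0r addr0; apply: eq_bigr => v _; rewrite !inE.
  have H z : ((v, z) == (x, y)) || ((v, z) \in C) = ((v, z) \in C).
    by case: eqP => // ->; rewrite xyC.
  by rewrite !H.
rewrite mul1r (bigD1_seq x)//= [in RHS](bigD1_seq x)//= [RHS]addrAC.
congr (_ + _); last first.
  by apply: eq_bigr => v /negbTE vx; rewrite !inE !xpair_eqE vx.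
have H z (g : bool) : (x + z == y) = g ->
    ((x, x + z) \notin (x, y) :: C)%:R = ((x, x + z) \notin C)%:R - g%:R :> R.
  move=> <-; rewrite inE xpair_eqE eqxx /=; case: eqP => /= [->|_].
    by rewrite xyC subrr.
  by rewrite subr0.
rewrite (H (- e1 d) _ erefl) (H (e1 d) _ erefl).
have H' z : (x + z == y) = (y - x == z) by rewrite eq_sym subr_eq addrC.
rewrite !H'; ring.
Qed.

End Steps.

(** * Transition probabilities, drift and variance *)

Section Walk.
Variables (R : realType) (d : nat) (a : R) (i0 : 'I_d).
Hypotheses (a_gt0 : 0 < a) (i00 : i0 = 0%N :> nat).
Local Notation step := ('I_d * bool)%type.

Definition weight (s : seq step) (e : step) : R :=
  if (endpoint s, endpoint s + unit_step e) \in trail s then 1 else a.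

Definition jump_proba (s : seq step) (e : step) : R :=
  weight s e / \sum_e' weight s e'.

(** A new arc moves both the imbalance and the coordinate, which gives [(1 - a) + a = 1] times
    [dir]; a repeated crossing moves only the coordinate, which gives [a] times [dir]. *)
Definition increment (s : seq step) (e : step) : R :=
  if (endpoint s, endpoint s + unit_step e) \in trail s then a * dir i0 R e
  else dir i0 R e.

Lemma weight_gt0 s e : 0 < weight s e.
Proof. by rewrite /weight; case: ifP. Qed.

Lemma sum_weight_gt0 s : 0 < \sum_e weight s e.
Proof.
rewrite (bigD1 (i0, true))//= ltr_pwDl ?weight_gt0//.
by apply: sumr_ge0 => e _; exact/ltW/weight_gt0.
Qed.

Lemma jump_proba_ge0 s e : 0 <= jump_proba s e.
Proof. by rewrite divr_ge0// ltW ?weight_gt0 ?sum_weight_gt0. Qed.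

Lemma sum_jump_proba s : \sum_e jump_proba s e = 1.
Proof. by rewrite -mulr_suml divff// gt_eqF ?sum_weight_gt0. Qed.

(** The cancellation behind the martingale property: the product does not depend on whether the arc
    is new. *)
Lemma weight_increment s e : weight s e * increment s e = a * dir i0 R e.
Proof. by rewrite /weight /increment; case: ifP; rewrite ?mul1r. Qed.

Lemma increment_mean s : \sum_e jump_proba s e * increment s e = 0.
Proof.
under eq_bigr => e _ do rewrite mulrAC weight_increment.
rewrite -mulr_suml (sum_dir_fun i0 (F := fun x => a * x)) ?mulr0//.
by rewrite mulrN1 mulr1 subrr mul0r.
Qed.

(** Each of the two steps along the first axis contributes at least [a * Num.min a 1] to the
    rate-weighted sum of squares, and the total rate is at most [1 + a] times the number of
    steps. *)
Definition min_var : R := a * (2 * Num.min a 1) / ((1 + a) * #|{: step}|%:R).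

Lemma card_step_gt0 : (0 < #|{: step}|)%N.
Proof. by apply/card_gt0P; exists (i0, true). Qed.

Lemma min_var_gt0 : 0 < min_var.
Proof.
have a1 : 0 < Num.min a 1 by rewrite lt_min a_gt0 /=.
by rewrite divr_gt0 ?mulr_gt0 ?addr_gt0// ltr0n card_step_gt0.
Qed.

Lemma increment_var s :
  min_var <= \sum_e jump_proba s e * increment s e ^+ 2.
Proof.
have ge0 : 0 <= a * (2 * Num.min a 1).
  by rewrite ltW// ?mulr_gt0// lt_min a_gt0 /=.
apply: (@le_trans _ _ (a * (2 * Num.min a 1) / \sum_e weight s e)).
  rewrite ler_wpM2l// lef_pV2 ?posrE ?sum_weight_gt0//; last first.
    by rewrite mulr_gt0 ?addr_gt0// ltr0n card_step_gt0.
  rewrite mulr_natr -sumr_const; apply: ler_sum => e _.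
  by rewrite /weight; case: ifP => _; rewrite ?lerDl ?lerDr// ltW.
(* One factor [increment] is absorbed by the rate through [weight_increment]; the other is [dir]
   times [a] or 1. *)
rewrite [leRHS](eq_bigr (fun e => a * (dir i0 R e * increment s e) /
    \sum_e weight s e)) => [|e _]; last first.
  by rewrite /jump_proba [a * _]mulrA -(weight_increment s e); ring.
rewrite -mulr_suml -mulr_sumr ler_wpM2r ?invr_ge0 ?(ltW (sum_weight_gt0 _))//.
rewrite ler_wpM2l ?(ltW a_gt0)//.
have -> : 2 * Num.min a 1 = \sum_e (Num.min a 1 * dir i0 R e ^+ 2).
  rewrite (sum_dir_fun i0 (F := fun x => Num.min a 1 * x ^+ 2)).
    by rewrite sqrrN expr1n mulr1 mulr_natl.
  by rewrite expr0n mulr0.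
apply: ler_sum => e _; rewrite /increment; case: ifP => _.
  by rewrite [leRHS]mulrCA -[in leRHS]expr2 ler_wpM2r ?sqr_ge0// ge_min lexx.
by rewrite -[leRHS]expr2 -[leRHS]mul1r ler_wpM2r ?sqr_ge0// ge_min lexx orbT.
Qed.

Lemma increment_bound s e : `|increment s e| <= 1 + a.
Proof.
have dir1 : `|dir i0 R e| <= 1.
  by rewrite /dir normrM normr_sign mulr1; case: eqP; rewrite ?normr1 ?normr0.
rewrite /increment; case: ifP => _.
  rewrite normrM gtr0_norm//; apply: (@le_trans _ _ a); last by rewrite lerDr.
  by rewrite -[leRHS]mulr1 ler_wpM2l// ltW.
by apply: le_trans dir1 _; rewrite lerDl ltW.
Qed.

(* The newly crossed arcs and the repeated crossings, counted with the sign of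
   their first coordinate, have drifts in the ratio [- a]. *)
Lemma mart_increment s : mart increment s =
  (1 - a) * imbalance R (trail s) + a * (endpoint s 0 i0)%:~R.
Proof.
elim: s => [|e s IH] /=; first by rewrite mxE !mulr0 addr0.
have -> : endpoint s + unit_step e - endpoint s = unit_step e.
  by rewrite addrC addKr.
rewrite IH -(dirE i00).
have -> : (endpoint s + unit_step e) 0 i0
    = endpoint s 0 i0 + unit_step e 0 i0 by rewrite mxE.
rewrite intrD unit_step_coord.
have -> : ((e.1 == i0)%:R * (-1) ^+ e.2)%:~R = dir i0 R e.
  by rewrite /dir intrM rmorph_sign; case: eqP.
by rewrite /increment; case: ifP => _ /=; ring.
Qed.

End Walk.

(** * The law of the first steps *)

Lemma mem_set_seq (U : eqType) (r : seq U) x : (x \in [set` r]) = (x \in r).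
Proof. by apply/idP/idP; rewrite in_setE. Qed.

Section Cylinders.
Variables (R : realType) (d : nat) (T : Type) (X : R -> T -> 'rV[int]_d).
Hypothesis Xrc : forall (w : T) (t : R), 0 <= t ->
  \forall s \near t^'+, X s w = X t w.
Hypothesis X0 : forall w : T, X 0 w = 0.
Local Notation step := ('I_d * bool)%type.

Fixpoint cylinder (s : seq step) : set T :=
  if s is _ :: s' then
    cylinder s' `&` [set w | position X (size s) w = Some (endpoint s)]
  else setT.

Lemma position_size s w :
  cylinder s w -> position X (size s) w = Some (endpoint s).
Proof.
case: s => [_|e s []//]; apply/position_Some.
by rewrite /Xtau /= X0 ltry.
Qed.

Lemma visitedP s w x : cylinder s w ->
  x \in visited s <-> exists2 k, (k <= size s)%N & position X k w = Some x.
Proof.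
elim: s => [|e s IH] sw.
  rewrite inE; split => [/eqP ->|[[|//] _]].
    by exists 0%N; rewrite ?(position_size sw).
  by rewrite (position_size sw) => -[<-].
rewrite [visited _]/= inE; split => [/orP[/eqP ->|]|[k]].
- by exists (size (e :: s)) => //; rewrite (position_size sw).
- by move=> /(IH sw.1)[k ks kx]; exists k => //; exact: leqW.
rewrite leq_eqVlt => /orP[/eqP ->|ks] kx.
  by move: kx; rewrite (position_size sw) => -[<-]; rewrite eqxx.
by apply/orP; right; apply/(IH sw.1); exists k.
Qed.

Lemma trailP s w x y : cylinder s w ->
  (x, y) \in trail s <-> exists2 k, (k < size s)%N &
    position X k w = Some x /\ position X k.+1 w = Some y.
Proof.
elim: s => [|e s IH] sw; first by split => // -[].
rewrite [trail _]/= inE; split => [/orP[/eqP [-> ->]|]|[k]].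
- by exists (size s) => //; rewrite (position_size sw) (position_size sw.1).
- by move=> /(IH sw.1)[k ks kx]; exists k => //; exact: leqW.
rewrite ltnS leq_eqVlt => /orP[/eqP ->|ks] [kx ky].
  move: kx ky; rewrite (position_size sw.1) (position_size sw) => -[<-] [<-].
  by rewrite eqxx.
by apply/orP; right; apply/(IH sw.1); exists k.
Qed.

Lemma range_cylinder s w : cylinder s w ->
  range_at X (tau X (size s) w) w = [set` visited s].
Proof.
move=> sw; rewrite range_at_tau; apply/seteqP; split => x /=.
  move=> [k [ks kf kx]]; apply/(visitedP _ sw).
  by exists k => //; apply/position_Some.
by move=> /(visitedP _ sw)[k ks /position_Some[kf kx]]; exists k.
Qed.

Lemma crossed_cylinder s w : cylinder s w ->
  crossed_at X (tau X (size s) w) w = [set` trail s].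
Proof.
move=> sw; rewrite crossed_at_tau//; apply/seteqP; split => -[x y] /=.
  move=> [k [ks kf [-> ->]]]; apply/(trailP _ _ sw); exists k => //.
  split; apply/position_Some => //; split => //.
  exact: le_lt_trans (tau_leS _ _ _) kf.
move=> /(trailP _ _ sw)[k ks [/position_Some[_ kx] /position_Some[kf ky]]].
by exists k; rewrite kx ky.
Qed.

Lemma boundary_imbalance_cylinder s w (i0 : 'I_d) : i0 = 0%N :> nat ->
  cylinder s w -> boundary_imbalance X (size s) w = imbalance R (trail s).
Proof.
move=> i00 sw; rewrite /boundary_imbalance /boundary_at.
rewrite (crossed_cylinder sw) (range_cylinder sw).
rewrite -(@sum_imbalance _ R (undup (visited s)) (trail s)) ?undup_uniq//;
  last by move=> x /trail_source; rewrite mem_undup.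
rewrite [RHS]fsbig_seq ?undup_uniq//.
under [LHS]eq_fsbigr do rewrite !mem_set_seq.
(* A visited site off the boundary has both its arcs along the first axis crossed, so its summand is
   0. *)
apply: fsbig_widen => v.
- by move=> /= [+ _]; rewrite mem_undup.
move=> [/=]; rewrite mem_undup => vs nv.
have H (b : bool) : (v, v + unit_step (i0, b)) \in trail s.
  apply: contrapT => h; apply: nv; split => //.
  by exists (v + unit_step (i0, b)); split => //; exists (i0, b).
have := H true; rewrite -opp_e1_unit_step// => ->.
by have := H false; rewrite -e1_unit_step// => ->; rewrite subrr.
Qed.

Definition signed_mart a (i0 : 'I_d) n w : R :=
  (1 - a) * boundary_imbalance X n w + a * (Xtau X n w 0 i0)%:~R.

Lemma signed_mart_cylinder a (i0 : 'I_d) s w : i0 = 0%N :> nat ->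
  cylinder s w -> signed_mart a i0 (size s) w = mart (increment a i0) s.
Proof.
move=> i00 sw; rewrite mart_increment// /signed_mart.
rewrite (boundary_imbalance_cylinder i00 sw).
by have /position_Some[_ ->] := position_size sw.
Qed.

Lemma determined_signed_mart a i0 n :
  determined_upto X (signed_mart a i0 n) n.
Proof.
move=> w w' h; rewrite /signed_mart (determined_imbalance Xrc h).
by rewrite (determined_Xtau X0 h).
Qed.

End Cylinders.

(** The generators only bound [tau] by real numbers; finiteness of a jump time is recovered as a
    union over integer bounds. *)
Lemma history_cylinder (R : realType) d disp (T : measurableType disp)
    (X : R -> T -> 'rV[int]_d) n s : (size s <= n)%N ->
  history X n (cylinder X s).
Proof.
(* With [T] carrying the sigma-algebra generated by [G], being in [history] becomes
   measurability. *)
pose G := [set E : set T | exists k, (k <= n)%N /\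
  ((exists x, E = [set w | Xtau X k w = x]) \/
   (exists t : R, E = [set w | (tau X k w <= t%:E)%E]))].
suff : (size s <= n)%N ->
    measurable (cylinder X s : set (g_sigma_algebraType G)).
  by [].
elim: s => [_|e s IH sn]; first exact: measurableT.
apply: measurableI; first by apply: IH; exact: ltnW.
set k := size _ in sn *; set x := endpoint _.
rewrite (_ : mkset _ = [set w | exists m : nat, (tau X k w <= m%:R%:E)%E] `&`
  [set w | Xtau X k w = x]).
  apply: measurableI; last first.
    by apply: sub_gen_smallest; exists k; split => //; left; exists x.
  apply: (@measurable_ex _ (g_sigma_algebraType G) nat
    (fun m => [set w | (tau X k w <= m%:R%:E)%E])) => m.
  by apply: sub_gen_smallest; exists k; split => //; right; exists m%:R.
apply/seteqP; split => w /=.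
  move=> /position_Some[h ->]; split => //.
  exists (Num.bound (fine (tau X k w))).
  rewrite -[leLHS](tau_fineK h) lee_fin ltW//.
  exact: archi_boundP (fine_tau_ge0 X k w).
move=> [[m hm] kx]; apply/position_Some; split => //.
exact: le_lt_trans hm (ltry _).
Qed.

(** * Probabilities of cylinders *)

Section CylinderProbability.
Variables (R : realType) (d : nat) (a : R) (disp : measure_display).
Variables (T : measurableType disp) (P : probability T R).
Variables (X : R -> T -> 'rV[int]_d) (hX : is_dORRW a P X) (i0 : 'I_d).
Hypotheses (a_gt0 : 0 < a) (i00 : i0 = 0%N :> nat).
Local Notation step := ('I_d * bool)%type.

Let Xrc := dORRW_right_continuous hX.
Let X0 := dORRW_start hX.

Lemma measurable_cylinder s : measurable (cylinder X s).
Proof.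
elim: s => [|e s IH]; first exact: measurableT.
apply: measurableI => //; apply: measurable_position Xrc _ _ => t x.
exact: dORRW_measurable hX _ _.
Qed.

(** On a cylinder the position and the rates are fixed, so the jump law applies. Taking holding time
    bound 0 keeps only the choice of the next site. *)
Lemma proba_cylinder s : P (cylinder X s) = (mass (jump_proba a) s)%:E.
Proof.
elim: s => [|e s IH]; first exact: probability_setT.
have := @dORRW_jump _ _ _ _ _ _ _ hX (size s) (cylinder X s) (endpoint s)
  (weight a s) (history_cylinder (X := X) (leqnn _)).
have rates w : cylinder X s w ->
  [/\ (tau X (size s) w < +oo)%E, Xtau X (size s) w = endpoint s &
    forall e, jump_rate X a (tau X (size s) w) w (endpoint s)
      (endpoint s + unit_step e) = weight a s e].
  move=> sw; have /position_Some[h1 h2] := position_size X0 sw.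
  split => // e'; rewrite /jump_rate /weight (crossed_cylinder Xrc X0 sw).
  by rewrite mem_set_seq.
move=> /(_ rates e 0 (lexx _)).
rewrite mulr0 expR0 mul1r IH -EFinM => <-; congr (P _).
apply/seteqP; split => w /= [sw].
  move=> /position_Some[h1 h2]; split => //; split => //.
  rewrite adde0; apply: (tau_ltS Xrc).
  exact: le_lt_trans (tau_leS _ _ _) h1.
by move=> [_ h1 h2]; split => //; apply/position_Some.
Qed.

Lemma cylinder_disjoint s : trivIset [set: step] (fun e => cylinder X (e :: s)).
Proof.
move=> e e' _ _ [w [[_ h] [_ h']]]; apply: unit_step_inj.
by move: h; rewrite /= in h' *; rewrite h' => -[/addrI].
Qed.

Lemma fsumE_step (F : step -> \bar R) :
  (\sum_(e \in [set: step]) F e = \sum_e F e)%E.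
Proof.
rewrite [RHS]fsbig_seq ?index_enum_uniq//; apply: eq_fsbigl.
by apply/seteqP; split => e //= _; rewrite mem_index_enum.
Qed.

(** The jump probabilities sum to 1, so the one-step extensions exhaust the cylinder up to a null
    set, the paths that stop or jump elsewhere. *)
Lemma proba_next E s : measurable E ->
  (P (E `&` cylinder X s) <= \sum_e P (E `&` cylinder X (e :: s)))%E.
Proof.
move=> mE; set U := \bigcup_(e : step) cylinder X (e :: s).
have fin_step : finite_set [set: step] by exact: finite_finset.
have mc := measurable_cylinder.
have mU : measurable U by apply: fin_bigcup_measurable.
have Us : U `<=` cylinder X s by move=> w [e _ []].
have PU : P U = P (cylinder X s).
  rewrite measure_fin_bigcup//; last exact: cylinder_disjoint.
  rewrite (fsumE_step (fun e => P (cylinder X (e :: s)))).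
  under eq_bigr do rewrite proba_cylinder.
  by rewrite proba_cylinder sumEFin /= -mulr_sumr sum_jump_proba// mulr1.
rewrite -(fsumE_step (fun e => P (E `&` cylinder X (e :: s)))).
rewrite -(measure_fin_bigcup P)//; last 2 first.
- move=> e e' _ _ [w [[_ h] [_ h']]].
  by apply: (@cylinder_disjoint s) => //; exists w.
- by move=> e _; exact: measurableI.
rewrite -setI_bigcupr -/U.
apply: (@le_trans _ _ (P ((E `&` U) `|` (cylinder X s `\` U)))).
  apply: le_measure; rewrite ?inE; first exact: measurableI.
    by apply: measurableU; [exact: measurableI|exact: measurableD].
  by move=> w [Ew sw]; have [Uw|Uw] := pselect (U w); [left|right].
apply: le_trans (measureU2 _ _ _) _; [exact: measurableI|exact: measurableD|].
have PD : (P (cylinder X s `\` U) <= 0)%E.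
  have -> : (P (cylinder X s `\` U) =
      P (cylinder X s) - P (cylinder X s `&` U))%E.
    by apply: measureD => //; apply: le_lt_trans (probability_le1 P _) (ltry _).
  by rewrite (setIidr Us) PU proba_cylinder subee.
rewrite -[leRHS]adde0; exact: leeD2l PD.
Qed.

(** Up to a null set the cylinders of length [n] cover the space, and [E] meets only those
    satisfying [Q]. *)
Lemma proba_le_sum_cylinder (E : set T) n (Q : pred (seq step)) :
  measurable E ->
  (forall w s, E w -> size s = n -> cylinder X s w -> Q s) ->
  (P E <= (\sum_(s <- walks step n | Q s) mass (jump_proba a) s)%:E)%E.
Proof.
move=> mE EQ.
have H k : (P E <= \sum_(s <- walks step k) P (E `&` cylinder X s))%E.
  elim: k => [|k IH]; first by rewrite /= big_seq1 setIT.
  rewrite big_walksS; apply: le_trans IH _.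
  by apply: lee_sum => s _; exact: proba_next.
apply: le_trans (H n) _.
rewrite -sumEFin [leRHS]big_mkcond big_seq [leRHS]big_seq.
apply: lee_sum => s /size_walks sn; case: ifP => Qs.
  rewrite -proba_cylinder; apply: le_measure; rewrite ?inE//.
  - by apply: measurableI => //; exact: measurable_cylinder.
  - exact: measurable_cylinder.
rewrite (_ : E `&` _ = set0) ?measure0//; apply/seteqP; split => // w [Ew sw].
by rewrite (EQ w s) in Qs.
Qed.

End CylinderProbability.

(** * The event A /\ B *)

Section Confining.
Variables (R : realType) (d : nat) (a : R) (disp : measure_display).
Variables (T : measurableType disp) (P : probability T R).
Variables (X : R -> T -> 'rV[int]_d) (hX : is_dORRW a P X) (i0 : 'I_d).
Hypotheses (a_gt0 : 0 < a) (i00 : i0 = 0%N :> nat).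

Let Xmeas := dORRW_measurable hX.
Let Xrc := dORRW_right_continuous hX.
Let X0 := dORRW_start hX.

Definition eventually_small (D : R) (m : nat) : set T :=
  [set w | forall n, (m <= n)%N ->
     `|signed_mart X a i0 n w| <= D * Num.sqrt n%:R].

Lemma measurable_eventually_small D m : measurable (eventually_small D m).
Proof.
apply: measurable_all => n.
apply: (@measurable_determined _ _ _ _ _ Xmeas Xrc n) => w w' h /=.
by rewrite (determined_signed_mart Xrc X0 a i0 h).
Qed.

(** The moving barrier [D * Num.sqrt n] is replaced by its largest value up to time [N], to fit the
    constant barrier of [confined]. *)
Lemma confined_cylinder D m N w s : 0 <= D -> eventually_small D m w ->
  (size s <= N)%N -> cylinder X s w ->
  confined (increment a i0) m (D * Num.sqrt N%:R) s.
Proof.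
move=> D0 hw; elim: s => [|e s IH] sN sw; rewrite [confined _ _ _ _]/=;
  (apply/andP; split; last by rewrite ?IH ?(ltnW sN) //; case: sw).
  by apply/implyP => _; rewrite normr0 mulr_ge0.
apply/implyP => ms; rewrite -/(mart _ (e :: s)).
rewrite -(signed_mart_cylinder Xrc X0 a i00 sw).
by apply: le_trans (hw _ ms) _; rewrite ler_wpM2l// ler_wsqrtr// ler_nat.
Qed.

Lemma proba_eventually_small D m : 0 < D ->
  (P (eventually_small D m) <= (8 * D ^+ 2 / min_var d a)%:E)%E.
Proof.
move=> D0.
have c0 : 0 < min_var d a by exact: min_var_gt0.
(* At least half of the [N] steps come after [m], and the step bound [1 + a] is at most
   [D * Num.sqrt N]. Hence the ratio of [4 * D ^+ 2 * N] to [N / 2] in the final bound. *)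
pose N := (maxn m.*2 (Num.bound (((1 + a) / D) ^+ 2))).+1.
have mN : (m.*2 <= N)%N by rewrite ltnW// ltnS leq_maxl.
have KN : 1 + a <= D * Num.sqrt N%:R.
  rewrite mulrC -ler_pdivrMr//.
  have Ka0 : 0 <= (1 + a) / D by rewrite divr_ge0 ?ltW// addr_gt0.
  rewrite -(ger0_norm Ka0) -sqrtr_sqr ler_wsqrtr//.
  apply: le_trans (ltW (archi_boundP (sqr_ge0 _))) _.
  by rewrite ler_nat ltnW// ltnS leq_maxr.
have N_gt0 : (0 < N)%N by [].
clearbody N.
apply: le_trans (@proba_le_sum_cylinder _ _ _ _ _ _ _ hX i0 a_gt0 _ N
  (confined (increment a i0) m (D * Num.sqrt N%:R)) _ _) _.
- exact: measurable_eventually_small.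
- by move=> w s hw sN sw; apply: confined_cylinder (ltW D0) hw _ sw; rewrite sN.
rewrite lee_fin ler_pdivlMr//.
have mN' : (m <= N)%N by apply: leq_trans mN; rewrite -addnn leq_addr.
have K0 : 0 <= 1 + a by rewrite addr_ge0// ltW.
have := sum_confined (jump_proba_ge0 i0 a_gt0) (sum_jump_proba i0 a_gt0)
  (increment_mean a i0) (increment_var i0 a_gt0)
  (increment_bound i0 a_gt0) (ltW c0) K0 (D * Num.sqrt N%:R) mN'.
set g := \sum_(_ <- _ | _) _ => hg.
have g0 : 0 <= g.
  by apply: sumr_ge0 => s _; apply: mass_ge0; exact: jump_proba_ge0.
have N0 : 0 < N%:R :> R by rewrite ltr0n.
have sqN : Num.sqrt N%:R ^+ 2 = N%:R :> R by rewrite sqr_sqrtr// ltW.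
have half : N%:R / 2 <= (N - m)%:R :> R.
  rewrite natrB//.
  have : (m.*2)%:R <= N%:R :> R by rewrite ler_nat.
  by rewrite -muln2 natrM; lra.
have sq4 : (D * Num.sqrt N%:R + (1 + a)) ^+ 2 <= 4 * D ^+ 2 * N%:R.
  apply: (@le_trans _ _ ((2 * (D * Num.sqrt N%:R)) ^+ 2)).
    have Ds0 : 0 <= D * Num.sqrt N%:R by rewrite mulr_ge0// ltW.
    apply: lerXn2r; rewrite ?nnegrE ?(addr_ge0 _ K0) ?(mulr_ge0 _ Ds0)//.
    by rewrite [leRHS]mulr_natl mulr2n lerD2l.
  by rewrite !exprMn sqN mulrA (_ : 2 ^+ 2 = 4)// -natrX.
have : g * min_var d a * (N%:R / 2) <= 4 * D ^+ 2 * N%:R.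
  apply: le_trans sq4; apply: le_trans hg.
  rewrite mulrC (mulrC g) mulrA ler_wpM2r// mulrC ler_wpM2l//.
  exact: ltW.
have N2 : 0 < N%:R / 2 :> R by rewrite divr_gt0.
by move=> gN; rewrite -(ler_pM2r N2); lra.
Qed.

Lemma measurable_event_A eps u : measurable (event_A X eps u).
Proof.
apply: bigcup_measurable => m _.
apply: bigcap_measurable; first by exists m.+1 => /=.
move=> n _; apply: (@measurable_determined _ _ _ _ _ Xmeas Xrc n).
exact: determined_event_A.
Qed.

(** Testing the limit on the tolerances [1 / (k + 1)] leaves countable quantifiers over events of
    the skeleton. *)
Lemma measurable_event_B : measurable (event_B X).
Proof.
pose Z n w := n%:R `^ (- 2^-1) * boundary_imbalance X n w : R.
rewrite (_ : event_B X = [set w | forall k : nat, exists N : nat,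
    forall n : nat, ((N <= n)%N -> `|Z n w| < k.+1%:R^-1)]).
  apply: measurable_all => k; apply: measurable_ex => N.
  apply: measurable_all => n.
  apply: (@measurable_determined _ _ _ _ _ Xmeas Xrc n) => w w' h.
  by rewrite /Z (determined_imbalance Xrc h).
apply/seteqP; split => w /=.
  move=> /cvgr0Pnorm_lt h k.
  have [|N _ hN] := h k.+1%:R^-1; first by rewrite invr_gt0.
  by exists N.
move=> h; apply/cvgr0Pnorm_lt => e e0.
have [M _ hM] := near_infty_natSinv_lt (PosNum e0).
have [N hN] := h M; exists N => // n /= Nn.
by apply: lt_trans (hN _ Nn) _; exact: hM M (leqnn _).
Qed.

Lemma coord_le_norm (x : 'rV[int]_d) j : `|(x 0 j)%:~R| <= euclid_norm R x.
Proof.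
rewrite -sqrtr_sqr ler_wsqrtr// (bigD1 j)//= lerDl.
by apply: sumr_ge0 => k _; exact: sqr_ge0.
Qed.

Lemma Xtau_range n w : range_at X (tau X n w) w (Xtau X n w).
Proof.
rewrite range_at_tau//=.
have [h|] := boolP (tau X n w < +oo)%E; first by exists n.
(* With fewer than [n] jumps, [Xtau] falls back to the origin, which is in the range. *)
rewrite -leNgt leye_eq => /eqP h; exists 0%N; split => //; first exact: ltry.
by rewrite /Xtau h /= X0.
Qed.

Lemma event_AB_small (eps : R) (u : nat -> R) (D : R) :
  (2 <= d)%N -> 0 < eps -> eps < 1 ->
  (forall N, 0 < u N) ->
  u =o_\oo (fun N : nat => N%:R `^ (d%:R^-1) : R) -> 0 < D ->
  event_A X eps u `&` event_B X `<=` \bigcup_m eventually_small D m.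
Proof.
move=> d2 eps0 eps1 u0 /eqoP uo D0 w [[m0 _ hA] /cvgr0Pnorm_lt hB].
(* Chosen so that [(1 + a) * e + a * (2 * e) = D]: the imbalance is at most [e * Num.sqrt n] and the
   coordinate at most twice that. *)
pose e := D / (1 + 3 * a).
have e0 : 0 < e by rewrite divr_gt0// addr_gt0// mulr_gt0.
have [N1 _ h1] := uo e e0; have [N2 _ h2] := hB e e0.
(* The successor is needed because [event_A] only constrains indices strictly above [m0]; it also
   makes [n] positive. *)
exists (maxn m0 (maxn N1 N2)).+1 => // n nN.
have [nm nN1 nN2] : [/\ (m0 < n)%N, (N1 <= n)%N & (N2 <= n)%N].
  move: nN; rewrite !gtn_max => /and3P[-> /ltnW -> /ltnW ->] //.
have n1 : 1 <= n%:R :> R by rewrite ler1n (leq_ltn_trans _ nm).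
have n0 : 0 < n%:R :> R by apply: lt_le_trans n1.
have s0 : 0 < Num.sqrt n%:R :> R by rewrite sqrtr_gt0.
have un : u n <= e * Num.sqrt n%:R.
  have := h1 n nN1; rewrite /= gtr0_norm// ger0_norm ?powR_ge0//.
  move=> /le_trans; apply.
  rewrite ler_pM2l// -powR12_sqrt ?(ltW n0)//; apply: ler_powR => //.
  (* This is where [2 <= d] enters: the exponent [1 / d] is at most [1 / 2]. *)
  by rewrite lef_pV2 ?posrE ?ltr0n ?(ltnW d2)// (ler_nat R 2).
have imb : `|boundary_imbalance X n w| <= e * Num.sqrt n%:R.
  have := h2 n nN2; rewrite /= normrM powRN powR12_sqrt ?(ltW n0)//.
  rewrite normfV (gtr0_norm s0) mulrC ltr_pdivrMr// => /ltW //.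
have crd : `|(Xtau X n w 0 i0)%:~R| <= 2 * (e * Num.sqrt n%:R) :> R.
  apply: le_trans (coord_le_norm _ _) _.
  have [_ [+ _]] := hA n nm; move=> /(_ _ (Xtau_range n w)) /= /le_trans; apply.
  apply: (@le_trans _ _ (2 * u n)); first by rewrite ler_wpM2r ?ltW//; lra.
  by rewrite ler_wpM2l.
apply: le_trans (ler_normD _ _) _; rewrite !normrM (gtr0_norm a_gt0).
have a1 : `|1 - a| <= 1 + a.
  by apply: le_trans (ler_normB _ _) _; rewrite normr1 gtr0_norm.
have -> : D * Num.sqrt n%:R =
    (1 + a) * (e * Num.sqrt n%:R) + a * (2 * (e * Num.sqrt n%:R)).
  rewrite (_ : D = e * (1 + 3 * a)); first by ring.
  by rewrite /e divfK// gt_eqF// addr_gt0// mulr_gt0.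
apply: lerD; last by rewrite ler_pM2l.
by apply: ler_pM.
Qed.

End Confining.

Theorem theorem1p12 (R : realType) (d : nat) (a eps : R)
    (hd : (2 <= d)%N) (ha : 0 < a) (heps0 : 0 < eps) (heps1 : eps < 1)
    (disp : measure_display) (T : measurableType disp) (P : probability T R)
    (X : R -> T -> 'rV[int]_d) (hX : is_dORRW a P X)
    (u : nat -> R) (hu0 : forall N, 0 < u N)
    (hu : u =o_\oo (fun N : nat => N%:R `^ (d%:R^-1) : R)) :
  P (event_A X eps u `&` event_B X) = 0%E.
Proof.
pose i0 : 'I_d := Ordinal (ltnW hd).
have c0 : 0 < min_var d a by exact: min_var_gt0 i0 ha.
have mE : measurable (event_A X eps u `&` event_B X).
  apply: measurableI; first exact: measurable_event_A hX _ _.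
  exact: measurable_event_B hX.
have small D : 0 < D ->
    (P (event_A X eps u `&` event_B X) <= (8 * D ^+ 2 / min_var d a)%:E)%E.
  move=> D0; pose F := eventually_small a X i0 D.
  have mF n : measurable (F n) by exact: measurable_eventually_small hX _ _ _.
  have mUF : measurable (\bigcup_n F n) by exact: bigcupT_measurable.
  (* The events [F n] increase with [n], so the bound, uniform in [n], passes to their union. *)
  apply: (@le_trans _ _ (P (\bigcup_n F n))).
    apply: le_measure; rewrite ?inE//.
    exact: event_AB_small hX i0 ha _ _ _ hd heps0 heps1 hu0 hu D0.
  have Fmono : {homo F : n m / (n <= m)%N >-> (n <= m)%O}.
    move=> n m nm; apply/subsetPset => w hw k mk; apply: hw.
    exact: leq_trans mk.
  have cvgF := nondecreasing_cvg_mu (mu := P) mF mUF Fmono.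
  rewrite -(cvg_lim _ cvgF)//; apply: lime_le.
    by apply/cvg_ex; eexists; exact: cvgF.
  by apply: nearW => n; exact: proba_eventually_small.
have Pfin : P (event_A X eps u `&` event_B X) \is a fin_num.
  exact: fin_num_measure.
apply/eqP; rewrite eq_le measure_ge0 andbT.
rewrite -(fineK Pfin) in small *; set x := fine _ in small *.
rewrite lee_fin leNgt; apply/negP => x0.
(* With [D ^+ 2] equal to this value the bound becomes [x / 2], which contradicts [0 < x]. *)
have y0 : 0 < min_var d a * x / 16 by rewrite divr_gt0// mulr_gt0.
have := small (Num.sqrt (min_var d a * x / 16)); rewrite sqrtr_gt0 => /(_ y0).
rewrite lee_fin (sqr_sqrtr (ltW y0)) ler_pdivlMr//.
have : 0 < min_var d a * x by rewrite mulr_gt0.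
by rewrite mulrC; lra.
Qed.
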